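(* Let $f:\mathbb{R}^n\times\mathbb{R}^p\to\mathbb{R}$ be continuously differentiable with $L$-Lipschitz gradient, $\mu_x$-strongly convex in $x$ and $\mu_y$-strongly concave in $y$ (in the precise sense given in the context), with $L\ge\mu_x\ge\mu_y>0$, and let $(x^\star,y^\star)$ be its unique saddle point. Let $h,\rho,\alpha$ satisfy $$0<h\le \frac{2}{15L},\qquad \rho=\frac{h\mu_x}{8},\qquad \frac{4}{4+h\sqrt{\mu_x\mu_y}}\le \alpha\le \frac{8}{8+h\sqrt{\mu_x\mu_y}},$$ let $(x_t,y_t,v_t)_{t\ge0}$ be generated by the PCE-DM iteration, and let $d_t^x,d_t^y$ and $\mathcal E_t$ be the associated directions and Lyapunov function (all defined in the context). Then for every $t\ge0$, $$\frac{1+\alpha}{2\alpha}\mathcal E_{t+1}-\mathcal E_t\le -\frac18\left(\lVert d_{t+1}^x-d_t^x\rVert^2+\lVert d_{t+1}^y-d_t^y\rVert^2\right).$$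
   Context: Norms and inner products are Euclidean. Assumptions on $f$: (i) $\lVert\nabla f(x',y')-\nabla f(x,y)\rVert\le L\lVert(x'-x,y'-y)\rVert$ for all $(x,y),(x',y')\in\mathbb{R}^n\times\mathbb{R}^p$, where $\nabla f=(\nabla_x f,\nabla_y f)$ is the full gradient; (ii) for all $x,x'\in\mathbb{R}^n$ and $y,y'\in\mathbb{R}^p$, $$f(x',y)\ge f(x,y)+\langle\nabla_x f(x,y),x'-x\rangle+\tfrac{\mu_x}{2}\lVert x'-x\rVert^2,$$ $$f(x,y')\le f(x,y)+\langle\nabla_y f(x,y),y'-y\rangle-\tfrac{\mu_y}{2}\lVert y'-y\rVert^2.$$ Under these assumptions $f$ has a unique saddle point $(x^\star,y^\star)$ (for $\min_x\max_y f$), $\nabla f(x^\star,y^\star)=0$, and we write $f^\star=f(x^\star,y^\star)$. PCE-DM iteration with parameters $h,\alpha,\rho$: given an arbitrary $(x_0,y_0)\in\mathbb{R}^n\times\mathbb{R}^p$ and $v_0=0$, for $t=0,1,2,\dots$ set $$\widetilde x_t=x_t-h\nabla_x f(x_t,y_t),\qquad \widetilde y_t=y_t+h\bigl(\nabla_y f(x_t,y_t)+v_t\bigr),$$ $$\widetilde v_t=\alpha v_t+\rho\nabla_y f(\widetilde x_t,\widetilde y_t),$$ $$x_{t+1}=x_t-h\nabla_x f(\widetilde x_t,\widetilde y_t),\qquad y_{t+1}=y_t+h\bigl(\nabla_y f(\widetilde x_t,\widetilde y_t)+\widetilde v_t\bigr),$$ $$v_{t+1}=\alpha v_t+\rho\nabla_y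 f(x_{t+1},y_{t+1}).$$ Directions: $d_t^x:=\nabla_x f(x_t,y_t)$ and $d_t^y:=\nabla_y f(x_t,y_t)+v_t$. Lyapunov function: $$\mathcal E_t:=-\frac{1-\alpha+2\rho}{2\alpha h}\bigl(f(x_t,y_t)-f^\star\bigr)+\frac12\lVert d_t^x\rVert^2+\frac12\lVert d_t^y\rVert^2+\frac{1-\alpha}{2\alpha h}\langle v_t,y_t-y^\star\rangle+\frac{(1-\alpha)^2}{4\alpha^2h^2}\lVert y_t-y^\star\rVert^2.$$ *)

(* Defs.v *)
From mathcomp Require Import all_boot all_order all_algebra.
From mathcomp Require Import all_classical all_reals all_analysis.

Set Implicit Arguments.
Unset Strict Implicit.
Unset Printing Implicit Defensive.

Import Order.TTheory GRing.Theory Num.Theory.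
Import numFieldNormedType.Exports.
Local Open Scope classical_set_scope.
Local Open Scope ring_scope.

(* The library norm `|u| on row vectors is the sup norm (and the norm on a
   product is the max), hence the Euclidean structure is spelled out here. Only
   the topology of the library norm, which is the Euclidean one, is used, in
   [differentiable], ['D_v] and [continuous]. *)
Definition dot (R : realType) (n : nat) (u v : 'rV[R]_n) : R :=
  \sum_(i < n) u 0 i * v 0 i.

Definition enorm (R : realType) (n : nat) (u : 'rV[R]_n) : R :=
  Num.sqrt (dot u u).

Definition enorm_pair (R : realType) (n p : nat)
    (w : 'rV[R]_n * 'rV[R]_p) : R :=
  Num.sqrt (dot w.1 w.1 + dot w.2 w.2).

Definition grad_x (R : realType) (n p : nat)
    (f : 'rV[R]_n * 'rV[R]_p -> R) (z : 'rV[R]_n * 'rV[R]_p) : 'rV[R]_n :=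
  \row_(i < n) 'D_(delta_mx 0 i, 0) f z.

Definition grad_y (R : realType) (n p : nat)
    (f : 'rV[R]_n * 'rV[R]_p -> R) (z : 'rV[R]_n * 'rV[R]_p) : 'rV[R]_p :=
  \row_(j < p) 'D_(0, delta_mx 0 j) f z.

Definition grad (R : realType) (n p : nat)
    (f : 'rV[R]_n * 'rV[R]_p -> R) (z : 'rV[R]_n * 'rV[R]_p) :
    'rV[R]_n * 'rV[R]_p :=
  (grad_x f z, grad_y f z).

Definition continuously_differentiable (R : realType) (n p : nat)
    (f : 'rV[R]_n * 'rV[R]_p -> R) : Prop :=
  (forall z, differentiable f z) /\ continuous (grad f).

Definition lipschitz_gradient (R : realType) (n p : nat) (L : R)
    (f : 'rV[R]_n * 'rV[R]_p -> R) : Prop :=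
  forall z z' : 'rV[R]_n * 'rV[R]_p,
    enorm_pair (grad f z' - grad f z) <= L * enorm_pair (z' - z).

Definition strongly_convex_x (R : realType) (n p : nat) (mux : R)
    (f : 'rV[R]_n * 'rV[R]_p -> R) : Prop :=
  forall (x x' : 'rV[R]_n) (y : 'rV[R]_p),
    f (x', y) >= f (x, y) + dot (grad_x f (x, y)) (x' - x)
                 + mux / 2 * enorm (x' - x) ^+ 2.

Definition strongly_concave_y (R : realType) (n p : nat) (muy : R)
    (f : 'rV[R]_n * 'rV[R]_p -> R) : Prop :=
  forall (x : 'rV[R]_n) (y y' : 'rV[R]_p),
    f (x, y') <= f (x, y) + dot (grad_y f (x, y)) (y' - y)
                 - muy / 2 * enorm (y' - y) ^+ 2.

(* Saddle point for min over x, max over y. *)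
Definition saddle_point (R : realType) (n p : nat)
    (f : 'rV[R]_n * 'rV[R]_p -> R) (xs : 'rV[R]_n) (ys : 'rV[R]_p) : Prop :=
  forall (x : 'rV[R]_n) (y : 'rV[R]_p),
    f (xs, y) <= f (xs, ys) /\ f (xs, ys) <= f (x, ys).

Definition pce_dm (R : realType) (n p : nat) (f : 'rV[R]_n * 'rV[R]_p -> R)
    (h alpha rho : R) (x : nat -> 'rV[R]_n) (y v : nat -> 'rV[R]_p) : Prop :=
  v 0%N = 0 /\
  forall t : nat,
    let xt := x t - h *: grad_x f (x t, y t) in
    let yt := y t + h *: (grad_y f (x t, y t) + v t) in
    let vt := alpha *: v t + rho *: grad_y f (xt, yt) in
    [/\ x t.+1 = x t - h *: grad_x f (xt, yt),
        y t.+1 = y t + h *: (grad_y f (xt, yt) + vt) &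
        v t.+1 = alpha *: v t + rho *: grad_y f (x t.+1, y t.+1)].

Definition dir_x (R : realType) (n p : nat) (f : 'rV[R]_n * 'rV[R]_p -> R)
    (x : nat -> 'rV[R]_n) (y : nat -> 'rV[R]_p) (t : nat) : 'rV[R]_n :=
  grad_x f (x t, y t).

Definition dir_y (R : realType) (n p : nat) (f : 'rV[R]_n * 'rV[R]_p -> R)
    (x : nat -> 'rV[R]_n) (y v : nat -> 'rV[R]_p) (t : nat) : 'rV[R]_p :=
  grad_y f (x t, y t) + v t.

Definition lyapunov (R : realType) (n p : nat) (f : 'rV[R]_n * 'rV[R]_p -> R)
    (h alpha rho : R) (xs : 'rV[R]_n) (ys : 'rV[R]_p)
    (x : nat -> 'rV[R]_n) (y v : nat -> 'rV[R]_p) (t : nat) : R :=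
  - ((1 - alpha + 2 * rho) / (2 * alpha * h)) * (f (x t, y t) - f (xs, ys))
  + 1 / 2 * enorm (dir_x f x y t) ^+ 2
  + 1 / 2 * enorm (dir_y f x y v t) ^+ 2
  + (1 - alpha) / (2 * alpha * h) * dot (v t) (y t - ys)
  + (1 - alpha) ^+ 2 / (4 * alpha ^+ 2 * h ^+ 2) * enorm (y t - ys) ^+ 2.

(* Main.v *)
(* With K = (1 - alpha) / (2 alpha h) and r = rho / (alpha h), the momentum
   update reads v' - v = h (r g' - 2 K v') with g' = grad_y f (x', y'), an
   implicit Euler step, and (1 + alpha) / (2 alpha) = 1 + h K, so that
   everything is expressed through quantities at time t + 1. The step itself
   uses the extrapolated direction instead of the new one d'; their difference e
   satisfies |e| <= |D| / 6, where D is the change of direction, because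
   h L <= 2 / 15. The coupling terms vanish by convex-concave monotonicity of the
   gradient, the terms in f are absorbed by strong convexity and concavity, and
   all remaining errors are dominated by the term - |D|^2 / 2 coming from
   |d'|^2 / 2 - |d|^2 / 2 = <d', D> - |D|^2 / 2. *)
Require Import Defs.
From mathcomp Require Import all_boot all_order all_algebra.
From mathcomp Require Import all_classical all_reals all_analysis.
From mathcomp Require Import ring lra.

Import Order.TTheory GRing.Theory Num.Theory.
Import numFieldNormedType.Exports.
Local Open Scope ring_scope.

(** * Euclidean inner product and Young's inequality *)

Section Dot.
Context {R : realType} {n : nat}.
Implicit Types (u v w : 'rV[R]_n) (a : R).

Lemma dotC u v : dot u v = dot v u.
Proof. by apply: eq_bigr => i _; rewrite mulrC. Qed.

Lemma dotDl u v w : dot (u + v) w = dot u w + dot v w.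
Proof. by rewrite /dot -big_split; apply: eq_bigr => i _; rewrite mxE mulrDl. Qed.

Lemma dotZl a u v : dot (a *: u) v = a * dot u v.
Proof. by rewrite /dot mulr_sumr; apply: eq_bigr => i _; rewrite mxE mulrA. Qed.

Lemma dotNl u v : dot (- u) v = - dot u v.
Proof. by rewrite -scaleN1r dotZl mulN1r. Qed.

Lemma dotDr u v w : dot u (v + w) = dot u v + dot u w.
Proof. by rewrite dotC dotDl !(dotC u). Qed.

Lemma dotZr a u v : dot u (a *: v) = a * dot u v.
Proof. by rewrite dotC dotZl dotC. Qed.

Lemma dotNr u v : dot u (- v) = - dot u v.
Proof. by rewrite dotC dotNl dotC. Qed.

Definition dotE := (dotDl, dotDr, dotZl, dotZr, dotNl, dotNr).

Lemma dot_ge0 u : 0 <= dot u u.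
Proof. by apply: sumr_ge0 => i _; rewrite -expr2 sqr_ge0. Qed.

Lemma enorm_sqr u : enorm u ^+ 2 = dot u u.
Proof. by rewrite sqr_sqrtr // dot_ge0. Qed.

(** Expand [|a u - v / 2|^2 >= 0] and divide by [a]. *)
Lemma dot_young a u v : 0 < a -> dot u v <= a * dot u u + dot v v / (4 * a).
Proof.
move=> a0; rewrite -subr_ge0.
have := dot_ge0 (a *: u - 2^-1 *: v); rewrite !dotE (dotC v u) => le0.
rewrite -(pmulr_rge0 _ a0); apply: le_trans le0 _; rewrite le_eqVlt; apply/orP; left.
apply/eqP; field; exact: lt0r_neq0.
Qed.

End Dot.

(** * Energy estimates for the directions of one step *)

Section Step.
Context {R : realType}.

(* [d], [d'] and [dt] are the [x]-directions at [z_t], [z_{t+1}] and at the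
   extrapolated point. *)
Lemma x_energy_bound {n : nat} (d d' dt : 'rV[R]_n) (h K r mux : R) :
  0 < h -> 0 < K -> 8 * K <= mux -> 0 < r -> r <= 31 / 240 * mux ->
  h * mux <= 2 / 15 ->
  h * (- mux * dot dt dt + 2 / 15 * K * dot dt dt + (K + r) * dot d dt
       + K / 2 * dot d' d')
  <= 1 / 15 * (dot (d' - d) (d' - d) + dot (d' - dt) (d' - dt)).
Proof.
move=> h0 K0 Kmu r0 rmu hmu.
have mu0 : 0 < mux by lra.
(* Everything is expanded around [dt], since [- mux * dot dt dt] is the term that absorbs the
   others. *)
set D := d' - d; set e := d' - dt.
have Ed : d = dt + e - D by apply/rowP => i; rewrite !mxE; ring.
have Ed' : d' = dt + e by apply/rowP => i; rewrite !mxE; ring.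
clearbody D e; subst d d'.
have A0 := dot_ge0 dt; have N0 := dot_ge0 D; have E0 := dot_ge0 e.
have q0 : 0 < 1 / 4 :> R by lra.
have y1 := dot_young (1/4) dt e q0.
have y2 := dot_young (1/4) dt (- D) q0.
have y3 := dot_young (1/2) dt e ltac:(lra).
move: y1 y2 y3; rewrite !dotE (dotC e dt) (dotC D dt) => y1 y2 y3.
set A := dot dt dt in A0 y1 y2 y3 *; set N := dot D D in N0 y2 *.
set E := dot e e in E0 y1 y3 *.
set p := dot dt e in y1 y2 y3 *; set q := dot dt D in y2 *.
clearbody A N E p q.
have b1 : (K + r) * (A + p - q) <= (61 / 240 * mux) * (3 / 2 * A + E + N).
  apply: (@le_trans _ _ ((K + r) * (3 / 2 * A + E + N))).
    by apply: ler_wpM2l; lra.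
  by apply: ler_wpM2r; lra.
have b2 : K / 2 * (A + p + (p + E)) <= mux / 16 * (2 * A + 2 * E).
  apply: (@le_trans _ _ (K / 2 * (2 * A + 2 * E))).
    by apply: ler_wpM2l; lra.
  by apply: ler_wpM2r; lra.
have b3 : 2 / 15 * K * A <= mux / 60 * A by apply: ler_wpM2r; lra.
have b4 : 0 <= mux * A by apply: mulr_ge0; lra.
have b5 : (h * mux) * (N + E) <= 2 / 15 * (N + E) by apply: ler_wpM2r; lra.
apply: (@le_trans _ _ (h * (mux * (1 / 2 * (N + E))))); last lra.
rewrite ler_pM2l //.
have b6 : 0 <= mux * N by apply: mulr_ge0; lra.
have b7 : 0 <= mux * E by apply: mulr_ge0; lra.
lra.
Qed.

(* The [v]-update is implicit in [v' = v_{t+1}]: [v' - v = h (r g' - 2 K v')],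
   which makes all terms in [g'] and [v'] alone cancel or recombine into the
   full direction [g' + v']. *)
Lemma y_energy_identity {p : nat} (g g' v' dt Y' : 'rV[R]_p) (h K r : R) :
  let v := v' - h *: (r *: g' - (2 * K) *: v') in
  let Y := Y' - h *: dt in
  let d := g + v in
  let d' := g' + v' in
  let e := d' - dt in
  let D := d' - d in
  (1 + h * K) * (dot d' d' / 2 + K * dot v' Y' + K ^+ 2 * dot Y' Y')
  - (dot d d / 2 + K * dot v Y + K ^+ 2 * dot Y Y) - (K + r) * h * dot g' dt
  = (1 + h * K) * dot dt (g' - g) + dot e D - dot D D / 2
    + h * K * (- dot d' d' / 2 + dot d' e - dot D dt
               + K * dot (d' - 2 *: e) Y' + K ^+ 2 * dot Y' Y'
               + (K + r) * dot g' Y' - h * K * dot dt dt).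
Proof.
rewrite /= !dotE ?(dotC g' g) ?(dotC v' g) ?(dotC v' g') ?(dotC dt g)
  ?(dotC dt g') ?(dotC dt v') ?(dotC Y' g) ?(dotC Y' g') ?(dotC Y' v')
  ?(dotC Y' dt).
move: (dot g g) (dot g g') (dot g v') (dot g dt) (dot g Y') (dot g' g')
  (dot g' v') (dot g' dt) (dot g' Y') (dot v' v') (dot v' dt) (dot v' Y')
  (dot dt dt) (dot dt Y') (dot Y' Y') => *.
by field.
Qed.

Lemma y_energy_bound {p : nat} (d d' dt Y' : 'rV[R]_p) (h K : R) :
  let e := d' - dt in
  let D := d' - d in
  0 < h -> 0 < K -> h * K <= 1 / 60 ->
  h * K * (- dot d' d' / 2 + dot d' e - dot D dt
           + K * dot (d' - 2 *: e) Y' - 3 * K ^+ 2 * dot Y' Y'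
           + 1 / 15 * dot dt dt)
  <= 1 / 20 * (dot D D + dot e e).
Proof.
move=> e D h0 K0 hK.
have Edt : dt = d' - e by apply/rowP => i; rewrite !mxE; ring.
clearbody D e; subst dt.
have N0 := dot_ge0 D; have E0 := dot_ge0 e.
have hK0 : 0 < h * K by apply: mulr_gt0.
apply: (@le_trans _ _ (h * K * (3 * (dot D D + dot e e)))); last first.
  rewrite mulrA; apply: ler_wpM2r; lra.
rewrite ler_pM2l //.
(* This square gives [K <w, Y'> - 3 K^2 |Y'|^2 <= |w|^2 / 12] with [w = d' - 2 e], which removes
   [Y']. The coefficient of [|d'|^2] is then [- 1/2 + 1/12 + 1/15 = - 7/20]; the weights 3/32 and
   3/10 below use up exactly this amount. *)
have y0 := dot_ge0 (d' - 2 *: e - (6 * K) *: Y').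
have y1 := dot_young (3/32) d' e ltac:(lra).
have y2 := dot_young (3/10) d' (- D) ltac:(lra).
have y3 := dot_young (1/2) D e ltac:(lra).
move: y0 y1 y2 y3.
rewrite !dotE (dotC e d') (dotC D d') (dotC Y' d') (dotC Y' e) => y0 y1 y2 y3.
have := dot_ge0 d'.
move: (dot d' d') (dot e e) (dot D D) (dot d' e) (dot d' D) (dot D e)
  (dot d' Y') (dot e Y') (dot Y' Y') N0 E0 y0 y1 y2 y3 => *.
lra.
Qed.

End Step.

(** * Inequalities from smoothness, convexity-concavity and the saddle point *)

Section Oracle.
Context {R : realType} {n p : nat} {f : 'rV[R]_n * 'rV[R]_p -> R}.

Lemma lipschitz_gradient_sqr (L : R) (x x' : 'rV[R]_n) (y y' : 'rV[R]_p) :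
  0 < L -> lipschitz_gradient L f ->
  dot (grad_x f (x', y') - grad_x f (x, y)) (grad_x f (x', y') - grad_x f (x, y))
  + dot (grad_y f (x', y') - grad_y f (x, y)) (grad_y f (x', y') - grad_y f (x, y))
  <= L ^+ 2 * (dot (x' - x) (x' - x) + dot (y' - y) (y' - y)).
Proof.
move=> L0 /(_ (x, y) (x', y')); rewrite /enorm_pair /=.
rewrite -ler_sqr ?nnegrE ?mulr_ge0 ?sqrtr_ge0 ?(ltW L0) //.
by rewrite exprMn !sqr_sqrtr // addr_ge0 // dot_ge0.
Qed.

(** Compare both points with the mixed points [(x', y)] and [(x, y')]: in the sum of the four
    inequalities all values of [f] cancel. *)
Lemma saddle_monotone (mux muy : R) (x x' : 'rV[R]_n) (y y' : 'rV[R]_p) :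
  strongly_convex_x mux f -> strongly_concave_y muy f ->
  mux * dot (x' - x) (x' - x) + muy * dot (y' - y) (y' - y)
  <= dot (grad_x f (x', y') - grad_x f (x, y)) (x' - x)
     - dot (grad_y f (x', y') - grad_y f (x, y)) (y' - y).
Proof.
move=> cvx ccv.
have := cvx x x' y; have := cvx x' x y'; have := ccv x y y'; have := ccv x' y' y.
rewrite -(opprB x' x) -(opprB y' y) !enorm_sqr !dotE.
lra.
Qed.

(* Convexity is used at [(x, y)] and concavity at [(x', y')], so that the
   bound needs no smoothness. *)
Lemma saddle_decrease (mux muy : R) (x x' : 'rV[R]_n) (y y' : 'rV[R]_p) :
  0 <= mux -> 0 <= muy -> strongly_convex_x mux f -> strongly_concave_y muy f ->
  f (x, y) - f (x', y')
  <= - dot (grad_x f (x, y)) (x' - x) - dot (grad_y f (x', y')) (y' - y).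
Proof.
move=> mux0 muy0 cvx ccv.
have := cvx x x' y; have := ccv x' y' y; rewrite -(opprB y' y) !enorm_sqr dotNr.
have := mulr_ge0 mux0 (dot_ge0 (x' - x)).
have := mulr_ge0 muy0 (dot_ge0 (- (y' - y))).
lra.
Qed.

(** Concavity bounds [f (x, ys)] from above, and the saddle point bounds it from below by
    [f (xs, ys)]. The quadratic term later pays for [|y - ys|^2] in the energy. *)
Lemma saddle_gap (muy : R) (xs x : 'rV[R]_n) (ys y : 'rV[R]_p) :
  strongly_concave_y muy f -> saddle_point f xs ys ->
  dot (grad_y f (x, y)) (y - ys) + muy / 2 * dot (y - ys) (y - ys)
  <= f (x, y) - f (xs, ys).
Proof.
move=> ccv sad; have [_] := sad x ys; have := ccv x y ys.
rewrite -(opprB y ys) !enorm_sqr !dotE; lra.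
Qed.

End Oracle.

(** * Extrapolation error and decrease of the energy *)

Section Lyapunov.
Context {R : realType} {n p : nat} (f : 'rV[R]_n * 'rV[R]_p -> R).

(** The displacement from the extrapolated point to the new one is [h] times the difference of the
    error and the change of direction. The Lipschitz bound thus controls the error by [h L] times
    itself plus that change, and can be solved for the error. *)
Lemma extrapolation_error (L h rho : R) (x x' xt : 'rV[R]_n)
    (y y' yt v v' vt : 'rV[R]_p) :
  let d := grad_y f (x, y) + v in
  let d' := grad_y f (x', y') + v' in
  let dt := grad_y f (xt, yt) + vt in
  let e := grad_x f (x', y') - grad_x f (xt, yt) in
  let D := grad_x f (x', y') - grad_x f (x, y) in
  0 < L -> lipschitz_gradient L f -> 0 < h -> h * L <= 2 / 15 ->
  0 <= rho -> rho <= 1 / 60 ->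
  xt = x - h *: grad_x f (x, y) -> yt = y + h *: d ->
  x' = x - h *: grad_x f (xt, yt) -> y' = y + h *: dt ->
  v' = vt + rho *: (grad_y f (x', y') - grad_y f (xt, yt)) ->
  dot e e + dot (d' - dt) (d' - dt) <= (dot D D + dot (d' - d) (d' - d)) / 36.
Proof.
move=> d d' dt e D L0 lip h0 hL rho0 rho1 xtE ytE x'E y'E v'E.
have := lipschitz_gradient_sqr L xt x' yt y' L0 lip; rewrite -/e.
set ey := grad_y f (x', y') - grad_y f (xt, yt) => lipe.
have dE : d' - dt = (1 + rho) *: ey.
  by rewrite /d' /dt v'E -/ey /ey; apply/rowP => i; rewrite !mxE; ring.
have xE : x' - xt = h *: (e - D).
  rewrite x'E; apply/rowP => i; rewrite [in X in _ - X]xtE /e /D !mxE; ring.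
have yE : y' - yt = h *: ((d' - d) - (d' - dt)).
  by rewrite y'E; apply/rowP => i; rewrite [in X in _ - X]ytE !mxE; ring.
move: lipe; rewrite xE yE.
rewrite dE; move: (d' - d) => Dy; clearbody e D ey.
have : (h * L) ^+ 2 <= (2 / 15) ^+ 2.
  by rewrite ler_sqr ?nnegrE ?(mulr_ge0 (ltW h0) (ltW L0)) //; lra.
have : (1 + rho) ^+ 2 <= (61 / 60) ^+ 2 by rewrite ler_sqr ?nnegrE; lra.
have := dot_young (1/12) D (- e) ltac:(lra).
have := dot_young (1/12) Dy (- ((1 + rho) *: ey)) ltac:(lra).
have e0 := dot_ge0 e; have D0 := dot_ge0 D; have ey0 := dot_ge0 ey.
have Dy0 := dot_ge0 Dy.
rewrite !dotE (dotC e D) (dotC ey Dy).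
set q := (1 + rho) ^+ 2; set Q := (h * L) ^+ 2.
set S := dot e e + q * dot ey ey.
move=> y1 y2 q1 Q1 lipe.
have q0 : 1 <= q by rewrite -[1](expr1n _ 2) ler_sqr ?nnegrE; lra.
have Q0 : 0 <= Q by apply: sqr_ge0.
have W0 : 0 <= dot e e + dot ey ey by lra.
have S1 : S <= q * (dot e e + dot ey ey).
  by rewrite /S mulrDr lerD2r ler_peMl.
have S0 : 0 <= S by rewrite /S addr_ge0 // mulr_ge0 //; lra.
set N := dot D D + dot Dy Dy.
(* Young with weight 1/12 gives [|e - D|^2 <= 7/6 |D|^2 + 7 |e|^2]. *)
have S2 : dot e e + dot ey ey <= Q * (7 / 6 * N + 7 * S).
  apply: le_trans (_ : Q * (dot e e - 2 * dot D e + dot D D +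
    (dot Dy Dy - 2 * ((1 + rho) * dot Dy ey) + q * dot ey ey)) <= _).
    by move: lipe; rewrite /Q /q; lra.
  by rewrite ler_wpM2l // /S /N; move: y1 y2; rewrite /q; lra.
have N0 : 0 <= N by rewrite addr_ge0.
(* The coefficient of [S] on the right is below 13/100, so [S] can be moved to the left. *)
have S3 : q * (dot e e + dot ey ey) <= (61 / 60) ^+ 2 * ((2 / 15) ^+ 2 * (7 / 6 * N + 7 * S)).
  apply: (@le_trans _ _ ((61 / 60) ^+ 2 * (dot e e + dot ey ey))).
    by rewrite ler_wpM2r.
  apply: ler_wpM2l; first lra.
  by apply: le_trans S2 _; rewrite ler_wpM2r //; lra.
have -> : dot e e + (1 + rho) * ((1 + rho) * dot ey ey) = S by rewrite /S /q; ring.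
lra.
Qed.

Definition energy (K r : R) (xs : 'rV[R]_n) (ys : 'rV[R]_p)
    (x : 'rV[R]_n) (y v : 'rV[R]_p) : R :=
  - (K + r) * (f (x, y) - f (xs, ys))
  + dot (grad_x f (x, y)) (grad_x f (x, y)) / 2
  + dot (grad_y f (x, y) + v) (grad_y f (x, y) + v) / 2
  + K * dot v (y - ys) + K ^+ 2 * dot (y - ys) (y - ys).

(** Once inner products are generalized to scalars, the claim is a linear combination of suitably
    scaled estimates; the proof prepares these multiples for the final [lra]. *)
Lemma energy_step (L mux muy h rho K r : R) (xs : 'rV[R]_n) (ys : 'rV[R]_p)
    (x x' xt : 'rV[R]_n) (y y' yt v v' vt : 'rV[R]_p) :
  lipschitz_gradient L f -> strongly_convex_x mux f ->
  strongly_concave_y muy f -> saddle_point f xs ys ->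
  0 < muy -> mux <= L -> 0 < h -> h * L <= 2 / 15 ->
  0 <= rho -> rho <= 1 / 60 ->
  0 < K -> 8 * K <= mux -> 64 * K ^+ 2 <= mux * muy ->
  mux / 8 <= r -> r <= 31 / 240 * mux ->
  xt = x - h *: grad_x f (x, y) -> yt = y + h *: (grad_y f (x, y) + v) ->
  x' = x - h *: grad_x f (xt, yt) -> y' = y + h *: (grad_y f (xt, yt) + vt) ->
  v' = vt + rho *: (grad_y f (x', y') - grad_y f (xt, yt)) ->
  v = v' - h *: (r *: grad_y f (x', y') - (2 * K) *: v') ->
  (1 + h * K) * energy K r xs ys x' y' v' - energy K r xs ys x y v
  <= - (1 / 8) * (dot (grad_x f (x', y') - grad_x f (x, y))
                      (grad_x f (x', y') - grad_x f (x, y))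
     + dot (grad_y f (x', y') + v' - (grad_y f (x, y) + v))
           (grad_y f (x', y') + v' - (grad_y f (x, y) + v))).
Proof.
move=> lip cvx ccv sad muy0 muL h0 hL rho0 rho1 K0 Kmu K2 r1 r2 xtE ytE x'E y'E v'E vE.
have mu0 : 0 < mux by lra.
have L0 : 0 < L by lra.
have hmu : h * mux <= 2 / 15 by apply: le_trans hL; rewrite ler_pM2l.
have hK : h * K <= 1 / 60.
  have : h * (8 * K) <= h * mux by rewrite ler_pM2l.
  lra.
have hK0 : 0 < h * K by apply: mulr_gt0.
have err := @extrapolation_error L h rho x x' xt y y' yt v v' vt L0 lip h0 hL
  rho0 rho1 xtE ytE x'E y'E v'E.
have mono := saddle_monotone mux muy x x' y y' cvx ccv.
have dec := saddle_decrease mux muy x x' y y' (ltW mu0) (ltW muy0) cvx ccv.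
have gap := saddle_gap muy xs x' ys y' ccv sad.
have lipD := lipschitz_gradient_sqr L x x' y y' L0 lip.
move: err mono dec gap lipD; rewrite /energy /=.
have -> : x' - x = - h *: grad_x f (xt, yt).
  by rewrite x'E; apply/rowP => i; rewrite !mxE; ring.
have -> : y' - y = h *: (grad_y f (xt, yt) + vt).
  by rewrite y'E; apply/rowP => i; rewrite !mxE; ring.
have YE : y - ys = (y' - ys) - h *: (grad_y f (xt, yt) + vt).
  by rewrite y'E; apply/rowP => i; rewrite !mxE; ring.
rewrite YE.
move: (f (x, y)) (f (x', y')) (f (xs, ys)) => F F' Fs.
move: (y' - ys) => Y.
have yid := y_energy_identity (grad_y f (x, y)) (grad_y f (x', y')) v'
  (grad_y f (xt, yt) + vt) Y h K r.
move: yid; rewrite /= -vE.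
have xid (d d' dt : 'rV[R]_n) : dot d' d' / 2 - dot d d / 2
    = dot (d' - d) dt + dot (d' - dt) (d' - d) - dot (d' - d) (d' - d) / 2.
  by rewrite !dotE (dotC dt d') (dotC dt d) (dotC d' d); field.
move: (xid (grad_x f (x, y)) (grad_x f (x', y')) (grad_x f (xt, yt))).
have := @x_energy_bound _ _ (grad_x f (x, y)) (grad_x f (x', y'))
  (grad_x f (xt, yt)) h K r mux h0 K0 Kmu ltac:(lra) r2 hmu.
have := @y_energy_bound _ _ (grad_y f (x, y) + v) (grad_y f (x', y') + v')
  (grad_y f (xt, yt) + vt) Y h K h0 K0 hK.
move=> /=; rewrite (dotC _ (grad_y f (x', y') - grad_y f (x, y))).
move: (grad_y f (xt, yt) + vt) => dt; move: (grad_x f (xt, yt)) => et.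
move: (grad_x f (x, y)) (grad_x f (x', y')) => ex ex'.
move: (grad_y f (x, y)) (grad_y f (x', y')) => g g'.
move: (dot_young 3 (ex' - et) (ex' - ex) ltac:(lra)).
move: (dot_young 3 (g' + v' - dt) (g' + v' - (g + v)) ltac:(lra)).
move: (dot_young (1/15) et (- (ex' - ex)) ltac:(lra)).
have dt0 := dot_ge0 dt; have et0 := dot_ge0 et; have Y0 := dot_ge0 Y.
have EX0 := dot_ge0 (ex' - et); have EY0 := dot_ge0 (g' + v' - dt).
have NX0 := dot_ge0 (ex' - ex); have NY0 := dot_ge0 (g' + v' - (g + v)).
have g0 := dot_ge0 (g' - g).
rewrite !(dotZr, dotZl, dotNr, dotNl) (dotC et (ex' - ex)).
move: (dot (ex' - ex) (ex' - ex)) NX0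
  (dot (ex' - et) (ex' - et)) EX0 => NX NX0 EX EX0.
move: (dot (g' + v' - (g + v)) (g' + v' - (g + v))) NY0 => NY NY0.
move: (dot (g' + v' - dt) (g' + v' - dt)) EY0 => EY EY0.
move: (dot (g' - g) (g' - g)) g0 => G g0.
move: (dot dt dt) dt0 (dot et et) et0 (dot Y Y) Y0 => A A0 B B0 C C0.
move: (dot (ex' - ex) et) (dot (g' - g) dt) => mx my.
move: (dot (ex' - et) (ex' - ex)) (dot (g' + v' - dt) (g' + v' - (g + v))) => cx cy.
move: (dot ex et) (dot g' dt) (dot g' Y) => px py pY.
move: (dot ex ex) (dot ex' ex') (dot (g + v) (g + v)) (dot (g' + v') (g' + v')).
move: (dot (g' + v') (g' + v' - dt)) (dot (g' + v' - (g + v)) dt).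
move: (dot (g' + v' - 2 *: (g' + v' - dt)) Y).
move=> w1 w2 w3 w4 w5 w6 w7 yB yey yex ybd xbd xid' yid err mono dec gap lipD.
have Kr0 : 0 < K + r by lra.
have {}dec : (K + r) * (F - F') <= (K + r) * (h * px - h * py).
  by rewrite ler_pM2l //; lra.
have hKKr0 : 0 < h * K * (K + r) by apply: mulr_gt0.
have {}gap : h * K * (K + r) * (pY + muy / 2 * C) <= h * K * (K + r) * (F' - Fs).
  by rewrite ler_pM2l.
(* The bound on [K ^+ 2] says [4 K^2 <= (mux / 8) (muy / 2)]. Together with the [+ K^2 |Y|^2] of
   [y_energy_identity] this leaves the [- 3 K^2 |Y|^2] of [y_energy_bound]. *)
have gapY : h * K * (4 * K ^+ 2 * C) <= h * K * ((K + r) * (muy / 2) * C).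
  rewrite ler_pM2l // ler_wpM2r //.
  apply: (@le_trans _ _ (mux / 8 * (muy / 2))); first lra.
  by rewrite ler_wpM2r //; lra.
have {}mono : h * mux * B <= - mx - my.
  rewrite -(ler_pM2l h0).
  have : 0 <= muy * (h * (h * A)) by rewrite !mulr_ge0 // ltW.
  lra.
have monoK : 0 <= h * K * (- mx - my).
  apply: mulr_ge0; first exact: ltW.
  by apply: le_trans mono; rewrite !mulr_ge0 // ltW.
have {}lipD : NX <= 4 / 225 * (A + B).
  have AB0 : 0 <= A + B by rewrite addr_ge0.
  have hL2 : (h * L) ^+ 2 <= (2 / 15) ^+ 2.
    by rewrite ler_sqr ?nnegrE ?(mulr_ge0 (ltW h0) (ltW L0)) //; lra.
  have : (h * L) ^+ 2 * (A + B) <= (2 / 15) ^+ 2 * (A + B) by rewrite ler_wpM2r.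
  lra.
(* The coupling terms are [mx + (1 + h K) my = (1 + h K) (mx + my) - h K mx]. Monotonicity handles
   the sum; the remainder is bounded here, by the terms 2/15 and 1/15 reserved in the two energy
   bounds. *)
have {}yB : h * K * (- mx) <= h * K * (2 / 15 * B + 1 / 15 * A).
  by rewrite ler_pM2l //; lra.
have hKA : 0 <= h * K * (h * K * A) by rewrite mulr_ge0 ?mulr_ge0 // ltW.
(* With [N = NX + NY], the Young terms of weight 3 cost [(3/36 + 1/12) N = N / 6], and the energy
   bounds at most [1/15 (1 + 1/36) N]; subtracting [N / 2] leaves less than [- N / 8]. *)
lra.
Qed.

End Lyapunov.

(** * Translation from [alpha], [rho] to [K], [r] *)

Theorem lemma3p6 (R : realType) (n p : nat)
    (f : 'rV[R]_n * 'rV[R]_p -> R) (L mux muy : R)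
    (f_C1 : continuously_differentiable f)
    (f_lip : lipschitz_gradient L f)
    (f_cvx : strongly_convex_x mux f)
    (f_ccv : strongly_concave_y muy f)
    (mux_le_L : mux <= L) (muy_le_mux : muy <= mux) (muy_gt0 : 0 < muy)
    (xs : 'rV[R]_n) (ys : 'rV[R]_p) (xys_saddle : saddle_point f xs ys)
    (h alpha rho : R)
    (h_gt0 : 0 < h) (h_le : h <= 2 / (15 * L))
    (rhoE : rho = h * mux / 8)
    (alpha_ge : 4 / (4 + h * Num.sqrt (mux * muy)) <= alpha)
    (alpha_le : alpha <= 8 / (8 + h * Num.sqrt (mux * muy)))
    (x : nat -> 'rV[R]_n) (y v : nat -> 'rV[R]_p)
    (xyv_gen : pce_dm f h alpha rho x y v) (t : nat) :
  (1 + alpha) / (2 * alpha) * lyapunov f h alpha rho xs ys x y v t.+1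
    - lyapunov f h alpha rho xs ys x y v t
  <= - (1 / 8) * (enorm (dir_x f x y t.+1 - dir_x f x y t) ^+ 2
                  + enorm (dir_y f x y v t.+1 - dir_y f x y v t) ^+ 2).
Proof.
set s := Num.sqrt (mux * muy) in alpha_ge alpha_le.
have mux0 : 0 < mux by lra.
have L0 : 0 < L by lra.
have s2 : s ^+ 2 = mux * muy by rewrite sqr_sqrtr // mulr_ge0 // ltW.
have s0 : 0 < s by rewrite sqrtr_gt0 mulr_gt0.
have smu : s <= mux.
  by rewrite -ler_sqr ?nnegrE ?(ltW s0) ?(ltW mux0) // s2 expr2 ler_pM2l.
have hs0 : 0 < h * s by apply: mulr_gt0.
have {}alpha_ge : 4 <= alpha * (4 + h * s) by rewrite -ler_pdivrMr //; lra.
have {}alpha_le : alpha * (8 + h * s) <= 8 by rewrite -ler_pdivlMr //; lra.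
have a0 : 0 < alpha.
  rewrite ltNge; apply/negP => aN.
  have : alpha * (4 + h * s) <= 0 by rewrite mulr_le0_ge0 //; lra.
  lra.
have ahs0 : 0 < alpha * (h * s) by apply: mulr_gt0.
have ah0 : 0 < alpha * h by apply: mulr_gt0.
have a_neq0 := lt0r_neq0 a0; have h_neq0 := lt0r_neq0 h_gt0.
pose K := (1 - alpha) / (2 * alpha * h).
pose r := rho / (alpha * h).
have KE : 1 - alpha = 2 * (alpha * h) * K.
  by rewrite /K; field; rewrite h_neq0 a_neq0.
(* The upper bound on [alpha] gives [K > 0], the lower one [8 K <= s]. *)
have K0 : 0 < K by rewrite -(pmulr_rgt0 _ ah0); lra.
have K8 : 8 * K <= s by rewrite -(ler_pM2l ah0); lra.
have aV : 1 + 2 * h * K = alpha^-1.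
  by rewrite /K; field; rewrite h_neq0 a_neq0.
have rE : r = mux / 8 * (1 + 2 * h * K).
  by rewrite aV /r rhoE; field; rewrite h_neq0 a_neq0.
have hL : h * L <= 2 / 15.
  have : h * L <= 2 / (15 * L) * L by rewrite ler_pM2r.
  suff -> : 2 / (15 * L) * L = 2 / 15 by [].
  by field; exact: lt0r_neq0.
have hmu : h * mux <= 2 / 15 by apply: le_trans hL; rewrite ler_pM2l.
have hmu0 : 0 < h * mux by apply: mulr_gt0.
have hK : h * K <= 1 / 60.
  have : h * (8 * K) <= h * mux by rewrite ler_pM2l //; lra.
  lra.
have hK0 : 0 < h * K by apply: mulr_gt0.
have K2 : 64 * K ^+ 2 <= mux * muy.
  have : (8 * K) ^+ 2 <= s ^+ 2 by rewrite ler_sqr ?nnegrE //; lra.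
  rewrite s2; lra.
(* As [h K <= 1/60], the factor [1 + 2 h K] lies between 1 and 31/30. *)
have r1 : mux / 8 <= r by rewrite rE ler_peMr //; lra.
have r2 : r <= 31 / 240 * mux.
  have : mux / 8 * (1 + 2 * h * K) <= mux / 8 * (31 / 30).
    by rewrite ler_pM2l //; lra.
  rewrite rE; lra.
have lyapE k : lyapunov f h alpha rho xs ys x y v k
    = energy f K r xs ys (x k) (y k) (v k).
  rewrite /lyapunov /energy !enorm_sqr /dir_x /dir_y /K /r.
  move: (f _) (f _) (dot _ _) (dot _ _) (dot _ _) (dot _ _) => *.
  by field; rewrite h_neq0 a_neq0.
have cE : (1 + alpha) / (2 * alpha) = 1 + h * K.
  by rewrite /K; field; rewrite h_neq0 a_neq0.
have rho0 : 0 <= rho by lra.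
have rho1 : rho <= 1 / 60 by lra.
have {}K8 : 8 * K <= mux by apply: le_trans smu.
rewrite !lyapE cE !enorm_sqr.
have [_ /(_ t) [xS yS vS]] := xyv_gen.
set xt := x t - h *: grad_x f (x t, y t) in xS yS.
set yt := y t + h *: (grad_y f (x t, y t) + v t) in xS yS.
apply: (@energy_step _ _ _ f L mux muy h rho K r xs ys (x t) (x t.+1) xt
  (y t) (y t.+1) yt (v t) (v t.+1) (alpha *: v t + rho *: grad_y f (xt, yt)))
  => //.
- by rewrite {1}vS; apply/rowP => i; rewrite !mxE; ring.
(* Multiplied by [alpha], this is the momentum update, since [alpha (1 + 2 h K) = 1] and
   [alpha h r = rho]. *)
- apply: (scalerI a_neq0).
  have -> : alpha *: v t = v t.+1 - rho *: grad_y f (x t.+1, y t.+1).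
    by rewrite [in RHS]vS addrK.
  rewrite /r /K; move: (grad_y f _) (v t.+1) => g' v'.
  by apply/rowP => i; rewrite !mxE; field; rewrite h_neq0 a_neq0.
Qed.
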